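(* The Banach space $c_0$ is neither uniformly nor coarsely embeddable into any metric space of non zero generalized roundness. More generally, if $(Y,\varsigma)$ is any metric space which is Lipschitz universal for the class of all locally finite metric spaces and $(B,d)$ is any metric space with generalized roundness $\mathfrak{q}(B)\neq 0$ (possibly $\infty$), then there is neither a uniform embedding nor a coarse embedding of $Y$ into $B$.
   Context: $c_0$ is the space of real sequences converging to $0$, with the supremum norm. A metric space is locally finite if every ball of finite radius is a finite set. A Lipschitz embedding of $(X,d)$ into $(Y,\varsigma)$ is an injection $f:X\to Y$ such that both $f$ and $f^{-1}:f(X)\to X$ are Lipschitz maps. $(Y,\varsigma)$ is Lipschitz universal for a class $\mathscr{U}$ of metric spaces if every $(X,d)\in\mathscr{U}$ admits a Lipschitz embedding into $Y$. A uniform embedding of $(X,d)$ into $(Y,\varsigma)$ is an injection $f:X\to Y$ such that both $f$ and $f^{-1}:f(X)\to X$ are uniformly continuous. A map $f:(X,d)\to(Y,\varsigma)$ is a coarse embedding if there exist non-decreasing functions $\rho_1,\rho_2:[0,\infty)\to[0,\infty)$ with $\rho_1(d(x,y))\leq\varsigma(f(x),f(y))\leq\rho_2(d(x,y))$ for all $x,y\in X$ and $\lim_{t\to\infty}\rho_1(t)=\infty$. The generalized roundness $\mathfrak{q}(X)\in[0,\infty]$ of a metric space $(X,d)$ is the supremum of the set of all $p\geq 0$ such that for all integers $n\geq 2$ and all (not necessarily distinct) points $x_1,\dots,x_n,y_1,\dots,y_n\in X$, $$\sum_{1\leq i<j\leq n}\{d(x_i,x_j)^p+d(y_i,y_j)^p\}\leq\sum_{1\leq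 i,j\leq n}d(x_i,y_j)^p.$$ *)

(* Defs.v *)
(* MathComp-Analysis *)
From HB Require Import structures.
From mathcomp Require Import all_boot all_order all_algebra.
From mathcomp Require Import all_classical all_reals all_analysis.

Set Implicit Arguments.
Unset Strict Implicit.
Unset Printing Implicit Defensive.

Import Order.TTheory GRing.Theory Num.Theory.
Import numFieldNormedType.Exports.

Local Open Scope classical_set_scope.
Local Open Scope ring_scope.

(* A subset [A] of a metric space, seen as the type [set_type A], already
   carries the induced pseudometric; its distance is the restricted one. *)
Section subset_metric.
Context {R : realType} {X : metricType R} (A : set X).

Let dist (x y : A) : R := mdist (set_val x) (set_val y).

Let dist_ge0 x y : 0 <= dist x y. Proof. exact: mdist_ge0. Qed.

Let dist_positivity x y : dist x y = 0 -> x = y.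
Proof. by move=> /mdist_positivity/val_inj. Qed.

Let ballEdist (x : A) d : ball x d = [set y : A | dist x y < d].
Proof.
by rewrite -[LHS]/(set_val @^-1` ball (set_val x) d) ballEmdist.
Qed.

HB.instance Definition _ :=
  PseudoMetric_isMetric.Build R (A : Type) dist_ge0 dist_positivity ballEdist.

End subset_metric.

Definition cvg_to0 (R : realType) : {pred R^nat} :=
  mem [set u : R^nat | u @ \oo --> (0 : R)].

Arguments cvg_to0 R : clear implicits.

Record c0 (R : realType) :=
  C0 { c0_seq :> nat -> R ; c0_seqP : c0_seq \in cvg_to0 R }.

Section c0_normed.
Context {R : realType}.

HB.instance Definition _ := [isSub of c0 R for @c0_seq R].
HB.instance Definition _ := [Choice of c0 R by <:].

Let cvg_to0_submod : submod_closed (cvg_to0 R).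
Proof.
split; first by rewrite inE /=; exact: cvg_cst.
move=> a u v; rewrite !inE /= => u0 v0.
have : (fun n => a * u n + v n) @ \oo --> a * 0 + 0.
  by apply: cvgD => //; exact: cvgMl_tmp.
by rewrite mulr0 addr0.
Qed.

HB.instance Definition _ := GRing.isSubmodClosed.Build R R^nat (cvg_to0 R)
  cvg_to0_submod.
HB.instance Definition _ := [SubChoice_isSubLmodule of c0 R by <:].

Definition supnorm (u : c0 R) : R := sup (range (fun n => `|u n|)).

Let has_sup_c0 (u : c0 R) : has_sup (range (fun n => `|u n|)).
Proof.
split; first by exists `|u 0%N|; exists 0%N.
have /set_mem/= u0 := c0_seqP u.
have /cvg_seq_bounded [M [_ Mu]] : cvgn u by apply/cvg_ex; exists 0.
by exists (M + 1) => _ [n _ <-]; apply: Mu => //; rewrite ltrDl.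
Qed.

Let le_supnorm (u : c0 R) n : `|u n| <= supnorm u.
Proof. by apply: ub_le_sup; [exact: (has_sup_c0 u).2|exists n]. Qed.

Let supnorm_le (u : c0 R) c : (forall n, `|u n| <= c) -> supnorm u <= c.
Proof.
by move=> uc; apply: ge_sup; [exact: (has_sup_c0 u).1|move=> _ [n _ <-]].
Qed.

Let ler_supnormD u v : supnorm (u + v) <= supnorm u + supnorm v.
Proof.
apply: supnorm_le => n; apply: (le_trans (ler_normD (u n) (v n))).
by apply: lerD.
Qed.

Let supnormZ_le a (u : c0 R) : supnorm (a *: u) <= `|a| * supnorm u.
Proof.
apply: supnorm_le => n; rewrite [X in `|X|](_ : _ = a * u n)// normrM.
by apply: ler_wpM2l.
Qed.

Let supnormZ a (u : c0 R) : supnorm (a *: u) = `|a| * supnorm u.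
Proof.
apply/eqP; rewrite eq_le supnormZ_le /=.
have [->|a0] := eqVneq a 0.
  by rewrite normr0 mul0r (le_trans _ (le_supnorm _ 0%N)).
rewrite -[u in X in X <= _](scalerK a0) -ler_pdivlMl ?normr_gt0//.
by rewrite -normfV supnormZ_le.
Qed.

Let supnorm_eq0 u : supnorm u = 0 -> u = 0.
Proof.
move=> u0; apply/val_inj/funext => n /=; apply/eqP.
by rewrite -normr_le0 -u0.
Qed.

HB.instance Definition _ :=
  @Lmodule_isNormed.Build R (c0 R) supnorm ler_supnormD supnormZ supnorm_eq0.

Let dist (u v : c0 R) : R := `|u - v|.

Let dist_ge0 u v : 0 <= dist u v. Proof. exact: normr_ge0. Qed.

Let dist_positivity u v : dist u v = 0 -> u = v.
Proof. by move/normr0_eq0/eqP; rewrite subr_eq0 => /eqP. Qed.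

Let ballEdist (u : c0 R) d : ball u d = [set v | dist u v < d].
Proof. by rewrite -ball_normE. Qed.

HB.instance Definition _ :=
  PseudoMetric_isMetric.Build R (c0 R) dist_ge0 dist_positivity ballEdist.

End c0_normed.

(* For injective [f], the inverse map of [f], defined on the subset [range f]
   of the codomain. *)
Definition range_inv (X Y : Type) (f : X -> Y) (y : range f) : X :=
  sval (cid2 (set_valP y)).

Section embeddings.
Context {R : realType}.
Implicit Types X Y : metricType R.

Definition lipschitz_map X Y (f : X -> Y) : Prop :=
  exists k : R, forall x y, mdist (f x) (f y) <= k * mdist x y.

Definition lipschitz_embedding X Y (f : X -> Y) : Prop :=
  [/\ injective f, lipschitz_map f & lipschitz_map (@range_inv X Y f)].

Definition uniform_embedding X Y (f : X -> Y) : Prop :=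
  [/\ injective f, unif_continuous f & unif_continuous (@range_inv X Y f)].

(* [rho] restricts to a non-decreasing function from [0, +oo[ to itself; its
   values at negative arguments are irrelevant. *)
Definition nondecreasing_on_nonneg (rho : R -> R) : Prop :=
  (forall t, 0 <= t -> 0 <= rho t) /\
  (forall s t, 0 <= s -> s <= t -> rho s <= rho t).

Definition coarse_embedding X Y (f : X -> Y) : Prop :=
  exists rho1 rho2 : R -> R,
    [/\ nondecreasing_on_nonneg rho1, nondecreasing_on_nonneg rho2,
        forall x y,
          rho1 (mdist x y) <= mdist (f x) (f y) /\
          mdist (f x) (f y) <= rho2 (mdist x y)
      & rho1 t @[t --> +oo] --> +oo].

Definition locally_finite X : Prop :=
  forall (x : X) (r : R), finite_set (ball x r).

Definition lipschitz_universal (U : metricType R -> Prop) Y : Prop :=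
  forall X, U X -> exists f : X -> Y, lipschitz_embedding f.

Definition roundness_exponent X (p : R) : Prop :=
  0 <= p /\
  forall (n : nat) (x y : 'I_n -> X), (2 <= n)%N ->
    \sum_(i < n) \sum_(j < n | (i < j)%N)
        (mdist (x i) (x j) `^ p + mdist (y i) (y j) `^ p)
    <= \sum_(i < n) \sum_(j < n) mdist (x i) (y j) `^ p.

Definition generalized_roundness X : \bar R :=
  ereal_sup [set p%:E | p in [set p : R | roundness_exponent X p]].

End embeddings.

(* Main.v *)
Require Import Defs.
From mathcomp Require Import all_boot all_order all_algebra.
From mathcomp Require Import all_classical all_reals all_analysis.
From mathcomp Require Import zify ring lra.

(* If p > 0 is a roundness exponent of B and g maps the discrete torus
   (Z/2^(K+1))^N to B, then Psi v := sum_z d(g z, g (z + v))^p satisfies the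
   translation-invariant double simplex inequality.  Apply it to vectors a, b
   with coordinates 0 or +-t, where a random half of the coordinates is reserved
   for a and the other half for b: every difference b - a has coordinates +-t on
   the reserved set, while a - a' and b - b' have coordinates +-2t on a random
   quarter of it.  Hence the mean of Psi does not increase when t is doubled and
   the support is thinned by a factor 4.  After K steps, with N = 4^K, at least
   half of the vectors are still nonzero, which yields V^p <= 2 U^p, where U
   bounds the image of unit steps from above and V bounds the image of
   antipodal points (at distance 2^K) from below.  The tori embed in c0 as
   finite subsets separated by the integer value of one coordinate, so that
   their union is locally finite; scale 1 contradicts coarse embeddability and
   scale 2^-K uniform embeddability. *)

Set Implicit Arguments.
Unset Strict Implicit.
Unset Printing Implicit Defensive.

Import Order.TTheory GRing.Theory Num.Theory.
Import numFieldNormedType.Exports.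

Local Open Scope classical_set_scope.
Local Open Scope ring_scope.

(** * The double simplex inequality over a finite index type *)

Section DoubleSimplex.
Context {R : realType} {B : metricType R} {p : R}.
Hypotheses (p0 : 0 < p) (hp : roundness_exponent B p).
Let D (x y : B) : R := mdist x y `^ p.

(** Doubling the sum over [i < j] gives all ordered pairs, because the summand is symmetric and, [p]
    being positive, vanishes on the diagonal. *)
Lemma roundness_finType (S : finType) (a b : S -> B) : (1 < #|S|)%N ->
  \sum_s \sum_s' (D (a s) (a s') + D (b s) (b s')) <=
  2 * \sum_s \sum_s' D (a s) (b s').
Proof.
move=> S1.
have DC x y : D x y = D y x by rewrite /D metric_sym.
have D0 x : D x x = 0 by rewrite /D mdistxx powR0 ?gt_eqF.
pose E s s' := D (a s) (a s') + D (b s) (b s').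
have := hp.2 #|S| (a \o enum_val) (b \o enum_val) S1.
rewrite -(ler_pM2l (ltr0n _ 2)).
have tr (F : S -> S -> R) :
  \sum_s \sum_s' F s s' =
  \sum_(i < #|S|) \sum_(j < #|S|) F (enum_val i) (enum_val j).
  rewrite (reindex (@enum_val S predT)) /=; last exact/onW_bij/enum_val_bij.
  apply: eq_bigr => i _.
  by rewrite (reindex (@enum_val S predT)) //=; last exact/onW_bij/enum_val_bij.
rewrite !tr -/D; apply: le_trans; rewrite le_eqVlt; apply/orP; left; apply/eqP.
set n := #|S|; pose F (i j : 'I_n) := E (enum_val i) (enum_val j).
have FC i j : F i j = F j i by rewrite /F /E DC (DC (b _)).
have F0 i : F i i = 0 by rewrite /F /E !D0 addr0.
pose U := \sum_(i < n) \sum_(j < n | (i < j)%N) F i j.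
rewrite [LHS](_ : _ = \sum_(i < n) \sum_(j < n) F i j) //.
rewrite [RHS](_ : _ = U + U); last first.
  by rewrite mulr_natl mulr2n.
rewrite [X in _ = _ + X](_ : _ = \sum_(i < n) \sum_(j < n | (j < i)%N) F i j); last first.
  rewrite (exchange_big_dep xpredT) //=; apply: eq_bigr => i _.
  by apply: eq_bigr => j _; rewrite FC.
rewrite -big_split; apply: eq_bigr => i _.
rewrite (bigID (fun j : 'I_n => (i < j)%N)) /=; congr +%R.
rewrite (bigD1 i) ?ltnn//= F0 add0r; apply: eq_bigl => j.
by rewrite -leqNgt ltn_neqAle andbC.
Qed.
End DoubleSimplex.

(** * Sums over products of finite sets *)

Section FfunSums.
Context {R : realType} {I : finType}.

Lemma sum_ffun_pair (A C : finType) (f : {ffun I -> A} -> {ffun I -> C} -> R) :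
  \sum_w \sum_s f w s =
  \sum_(u : {ffun I -> A * C}) f [ffun i => (u i).1] [ffun i => (u i).2].
Proof.
rewrite pair_big /=.
rewrite (reindex (fun u : {ffun I -> A * C} =>
  ([ffun i => (u i).1], [ffun i => (u i).2]))) //=.
exists (fun q : {ffun I -> A} * {ffun I -> C} => [ffun i => (q.1 i, q.2 i)]).
  by move=> u _; apply/ffunP => i; rewrite !ffunE; case: (u i).
by move=> [w s] _ /=; congr pair; apply/ffunP => i; rewrite !ffunE.
Qed.

(** A fibre of the coordinatewise action of [h] is a product of [#|I|] fibres of [h], each of size
    [k]. *)
Lemma sum_ffun_comp (A C : finType) (h : A -> C) (k : nat)
    (f : {ffun I -> C} -> R) :
  (forall y, #|[pred x | h x == y]| = k) ->
  \sum_(u : {ffun I -> A}) f [ffun i => h (u i)] = (k ^ #|I|)%:R * \sum_w f w.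
Proof.
move=> hk.
rewrite (partition_big (fun u : {ffun I -> A} => [ffun i => h (u i)]) xpredT) //=.
rewrite mulr_sumr; apply: eq_bigr => w _.
rewrite (eq_bigr (fun=> f w)); last by move=> u /eqP ->.
rewrite sumr_const -[LHS]mulr_natl; congr (_%:R * _).
rewrite (@eq_card _ _ (family (fun i => [pred x | h x == w i]))); last first.
  move=> u; rewrite inE; apply/(_ =P _ :> {ffun I -> C})/familyP => [<- i|H].
    by rewrite inE ffunE.
  by apply/ffunP => i; rewrite ffunE; have := H i; rewrite inE => /eqP.
rewrite card_family /image_mem (@eq_map _ _ _ (fun=> k)); last first.
  by move=> i /=; rewrite hk.
rewrite cardE; elim: (enum I) => //= i e ->; by rewrite expnS.
Qed.
End FfunSums.

(** * Random sign vectors and the doubling step *)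

Section LazySums.
Context {R : realType} {I : finType} {H : zmodType}.
Variable Psi : {ffun I -> H} -> R.

Definition lazy_step (t : H) (b s : bool) : H :=
  if b then (if s then t else - t) else 0.

(* A law on [H] is encoded as the image of the uniform law on [T * bool]: [+-t]
   with equal probability on [r], [0] elsewhere. *)
Definition lazy_sum (T : finType) (r : pred T) (t : H) : R :=
  \sum_(w : {ffun I -> T * bool}) Psi [ffun i => lazy_step t (r (w i).1) (w i).2].

Hypothesis Psi_neg : forall (S : finType) (a b : S -> {ffun I -> H}),
  (1 < #|S|)%N ->
  \sum_s \sum_s' (Psi (a s' - a s) + Psi (b s' - b s)) <=
  2 * \sum_s \sum_s' Psi (b s' - a s).

Lemma lazy_sum_double (T : finType) (r : pred T) (t : H) : (0 < #|I|)%N ->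
  lazy_sum (fun x : T * bool * bool => r x.1.1 && x.1.2 && x.2) (t *+ 2) <=
  (4 ^ #|I|)%:R * lazy_sum r t.
Proof.
move=> I0.
(* The bit [(w i).2] reserves coordinate [i] for [a] or for [b]; [s] carries the signs. *)
pose a (w : {ffun I -> T * bool}) (s : {ffun I -> bool}) : {ffun I -> H} :=
  [ffun i => lazy_step t (r (w i).1 && (w i).2) (s i)].
pose b (w : {ffun I -> T * bool}) (s : {ffun I -> bool}) : {ffun I -> H} :=
  [ffun i => lazy_step t (r (w i).1 && ~~ (w i).2) (s i)].
have S1 : (1 < #|{ffun I -> bool}|)%N.
  by rewrite card_ffun card_bool (leq_exp2l 1).
have : \sum_w \sum_s \sum_s' (Psi (a w s' - a w s) + Psi (b w s' - b w s)) <=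
    \sum_w 2 * \sum_s \sum_s' Psi (b w s' - a w s).
  by apply: ler_sum => w _; exact: Psi_neg.
rewrite -mulr_sumr.
under eq_bigr do (under eq_bigr do rewrite big_split; rewrite big_split).
rewrite big_split /=.
pose T4 := (T * bool * bool * bool)%type.
have flat (f : {ffun I -> T4} -> R) :
    \sum_(w : {ffun I -> T * bool}) \sum_(s : {ffun I -> bool})
      \sum_(s' : {ffun I -> bool}) f [ffun i => (w i, s i, s' i)] = \sum_u f u.
  rewrite (sum_ffun_pair (fun (w : {ffun I -> T * bool}) (s : {ffun I -> bool}) =>
    \sum_(s' : {ffun I -> bool}) f [ffun i => (w i, s i, s' i)])).
  rewrite (sum_ffun_pair (fun (w : {ffun I -> T * bool * bool})
      (s' : {ffun I -> bool}) =>
    f [ffun i => ([ffun i => (w i).1] i, [ffun i => (w i).2] i, s' i)])).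
  apply: eq_bigr => u _; congr f; apply/ffunP => i; rewrite !ffunE.
  by case: (u i) => [[]].
(* Only the law of each coordinate matters: the uniform law on [T4] is pushed forward along [h]. *)
have red (C : finType) (h : T4 -> C) k (phi : C -> H) :
    (forall y, #|[pred x | h x == y]| = k) ->
    \sum_(w : {ffun I -> T * bool}) \sum_(s : {ffun I -> bool})
      \sum_(s' : {ffun I -> bool}) Psi [ffun i => phi (h (w i, s i, s' i))] =
    (k ^ #|I|)%:R * \sum_(u : {ffun I -> C}) Psi [ffun i => phi (u i)].
  move=> hk; rewrite -(sum_ffun_comp (fun u => Psi [ffun i => phi (u i)]) hk).
  rewrite -(flat (fun u => Psi [ffun i => phi ([ffun i => h (u i)] i)])).
  by do 3! (apply: eq_bigr => ? _); congr Psi; apply/ffunP => i; rewrite !ffunE.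
(* The sign flips in [h1], [h2] and [h3] preserve the uniform law on [T4]; they
   carry [a - a'], [b - b'] and [b - a] to the encoded laws. *)
pose h1 (x : T4) : T4 := (x.1.1, x.1.2 != x.2, x.2).
pose h2 (x : T4) : T4 := (x.1.1.1, ~~ x.1.1.2, x.1.2 != x.2, x.2).
pose h3 (x : T4) := (x.1.1.1, if x.1.1.2 then ~~ x.1.2 else x.2).
have h1K : involutive h1 by case=> [[[? []] []] []].
have h2K : involutive h2 by case=> [[[? []] []] []].
have k3 y : #|[pred x | h3 x == y]| = 4%N.
  (* The reserving bit and the sign that it leaves unread are free, so [e] lists the four preimages
     of [y]. *)
  pose e (q : bool * bool) : T4 :=
    (y.1, q.1, if q.1 then ~~ y.2 else q.2, if q.1 then q.2 else y.2).
  have e_inj : injective e.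
    by move=> [[] c] [[] d]; rewrite /e /= => -[] // ->.
  have -> : #|[pred x | h3 x == y]| = #|codom e|; last first.
    by rewrite card_codom // card_prod card_bool.
  apply: eq_card => x; rewrite inE; apply/eqP/codomP => [yE|[q ->]].
    rewrite /e -yE; case: {yE} x => [[[u []] c] d].
      by exists (true, d); rewrite /h3 /= negbK.
    by exists (false, c).
  by case: q => [[] q]; rewrite /h3 /e /= ?negbK -surjective_pairing.
pose L := lazy_sum (fun x : T * bool * bool => r x.1.1 && x.1.2 && x.2) (t *+ 2).
have doubled (h : T4 -> T4)
    (d : {ffun I -> T * bool} -> {ffun I -> bool} -> {ffun I -> H}) :
    involutive h ->
    (forall (w : {ffun I -> T * bool}) (s s' : {ffun I -> bool}) i,
      let u := h (w i, s i, s' i) in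
      (d w s' - d w s) i = lazy_step (t *+ 2) (r u.1.1.1 && u.1.1.2 && u.1.2) u.2) ->
    \sum_w \sum_s \sum_s' Psi (d w s' - d w s) = L.
  move=> hK hd; have hk y : #|[pred x | h x == y]| = 1%N.
    by rewrite (fintype.eq_card1 (x := h y)) // => x; rewrite !inE (inv_eq hK).
  have := red _ h 1%N (fun u =>
    lazy_step (t *+ 2) (r u.1.1.1 && u.1.1.2 && u.1.2) u.2) hk.
  rewrite exp1n mul1r => E; rewrite /L /lazy_sum -[RHS]E.
  apply: eq_bigr => w _; apply: eq_bigr => s _; apply: eq_bigr => s' _.
  by congr Psi; apply/ffunP => i; rewrite hd ffunE.
have aa : \sum_w \sum_s \sum_s' Psi (a w s' - a w s) = L.
  apply: (doubled h1) => // w s s' i; rewrite !ffunE /lazy_step /=.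
  by case: (r _); case: (w i).2; case: (s i); case: (s' i) => //=;
    rewrite ?subrr ?subr0 ?opprK ?mulr2n ?opprD.
have bb : \sum_w \sum_s \sum_s' Psi (b w s' - b w s) = L.
  apply: (doubled h2) => // w s s' i; rewrite !ffunE /lazy_step /=.
  by case: (r _); case: (w i).2; case: (s i); case: (s' i) => //=;
    rewrite ?subrr ?subr0 ?opprK ?mulr2n ?opprD.
have ab : \sum_w \sum_s \sum_s' Psi (b w s' - a w s) =
    (4 ^ #|I|)%:R * lazy_sum r t.
  rewrite [in RHS]/lazy_sum -(red _ h3 4%N (fun u => lazy_step t (r u.1) u.2) k3).
  apply: eq_bigr => w _; apply: eq_bigr => s _; apply: eq_bigr => s' _.
  congr Psi; apply/ffunP => i; rewrite !ffunE /h3 /lazy_step /=.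
  by case: (r _); case: (w i).2; case: (s i); case: (s' i) => //=;
    rewrite ?subrr ?subr0 ?sub0r ?opprK.
by rewrite aa bb ab -/L; lra.
Qed.
End LazySums.

(** In the expansion of [(M.-1 + 1) ^ M] the first two terms are each at least [M.-1 ^ M]. This is
    [(1 - 1/M) ^ M <= 1/2]. *)
Lemma leq_double_expn_pred M : (0 < M)%N -> (2 * M.-1 ^ M <= M ^ M)%N.
Proof.
case: M => // n _ /=; have := expnDn n 1 n.+1; rewrite addn1 => ->.
rewrite 2!big_ord_recl /= !exp1n !muln1 /bump /= bin0 bin1 subn0 mul1n subn1 /=.
have := leq_addr (\sum_(i < n)
  'C(n.+1, 1 + (1 + i)) * (n ^ (n.+1 - (1 + (1 + i))) * 1 ^ (1 + (1 + i))))%N.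
rewrite expnS; nia.
Qed.

(** * Iterating the doubling step *)

Section LazyIter.
Context {R : realType} {I : finType} {H : zmodType}.
Variable Psi : {ffun I -> H} -> R.
Hypothesis Psi_neg : forall (S : finType) (a b : S -> {ffun I -> H}),
  (1 < #|S|)%N ->
  \sum_s \sum_s' (Psi (a s' - a s) + Psi (b s' - b s)) <=
  2 * \sum_s \sum_s' Psi (b s' - a s).

(** The factor [(4 ^ K) ^ #|I|] is the ratio of the numbers of encodings on the two sides, so the
    bound compares means. Singling out one of [4 ^ K] elements encodes density [4 ^ -K]. *)
Lemma lazy_sum_iter (t : H) K : (0 < #|I|)%N ->
  exists (T : finType) (x0 : T), #|T| = (4 ^ K)%N /\
    lazy_sum Psi (pred1 x0) (t *+ (2 ^ K)) <=
    ((4 ^ K) ^ #|I|)%:R * lazy_sum Psi (xpredT : pred unit) t.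
Proof.
move=> I0; elim: K => [|K [T [x0 [cT le_T]]]].
  exists unit, tt; split; first by rewrite card_unit.
  rewrite exp1n mul1r mulr1n le_eqVlt; apply/orP; left; apply/eqP.
  by apply: eq_bigr => w _; congr Psi; apply/ffunP => i; rewrite !ffunE.
exists (T * bool * bool)%type, (x0, true, true); split.
  by rewrite !card_prod card_bool cT expnSr -mulnA.
rewrite expnSr mulrnA expnS expnMn natrM -mulrA.
apply: le_trans (ler_wpM2l (ler0n _ _) le_T).
apply: le_trans (lazy_sum_double Psi_neg _ _ I0).
rewrite le_eqVlt; apply/orP; left; apply/eqP.
apply: eq_bigr => w _; congr Psi; apply/ffunP => i; rewrite !ffunE /=.
by case: (w i) => [[[y []] []] s]; rewrite /= !xpair_eqE ?andbT ?andbF.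
Qed.

(** After [K] steps the vector is zero with probability [(1 - 4 ^ -K) ^ (4 ^ K) <= 1/2], so the
    final mean is at least [c / 2], while the initial one is at most [u]. *)
Lemma lazy_bound (t : H) K (u c : R) : #|I| = (4 ^ K)%N ->
  (forall v, 0 <= Psi v) -> 0 <= c ->
  (forall v : {ffun I -> H}, (forall i, v i = t \/ v i = - t) -> Psi v <= u) ->
  (forall v : {ffun I -> H},
    (forall i, v i = 0 \/ v i = t *+ 2 ^ K \/ v i = - (t *+ 2 ^ K)) ->
    (exists i, v i <> 0) -> c <= Psi v) ->
  t *+ 2 ^ K != 0 ->
  c <= 2 * u.
Proof.
move=> cI Psi0 c0 Pu Pc t0.
have I0 : (0 < #|I|)%N by rewrite cI expn_gt0.
have [T [x0 [cT le_T]]] := lazy_sum_iter t K I0.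
have up : lazy_sum Psi (xpredT : pred unit) t <= (2 ^ #|I|)%:R * u.
  apply: le_trans (_ : \sum_(w : {ffun I -> unit * bool}) u <= _); last first.
    by rewrite sumr_const card_ffun card_prod card_unit card_bool mul1n mulr_natl.
  apply: ler_sum => w _; apply: Pu => i; rewrite ffunE /lazy_step /=.
  by case: (w i).2; [left|right].
(* The encodings of the zero vector. *)
pose bad := [set w : {ffun I -> T * bool} | [forall i, (w i).1 != x0]]%SET.
have cbad : #|bad| = ((2 * (4 ^ K).-1) ^ #|I|)%N.
  rewrite (_ : 2 * _ = #|[pred x : T * bool | x.1 != x0]|)%N; last first.
    rewrite (@eq_card _ _ (predX (predC1 x0) predT)); last first.
      by move=> x; rewrite !inE andbT.
    by rewrite cardX cardC1 cT card_bool mulnC.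
  rewrite -card_ffun_on; apply: eq_card => w; rewrite inE.
  by apply/forallP/ffun_onP => h i; have := h i; rewrite inE.
have low : (\sum_(w in ~: bad) c) <= lazy_sum Psi (pred1 x0) (t *+ 2 ^ K).
  rewrite /lazy_sum [leRHS](bigID (fun w => w \in ~: bad)%SET) /=.
  rewrite -[leLHS]addr0; apply: lerD; last by apply: sumr_ge0.
  apply: ler_sum => w; rewrite !inE negb_forall => /existsP [i /negPn/eqP wi].
  apply: Pc => [j|]; last first.
    exists i; rewrite ffunE /lazy_step /= wi eqxx; case: (w i).2; apply/eqP => //.
    by rewrite oppr_eq0.
  rewrite ffunE /lazy_step /=; case: eqP => _; last by left.
  by case: (w j).2; right; [left|right].
have cbad2 : (2 * #|bad| <= #|{ffun I -> T * bool}|)%N.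
  rewrite cbad card_ffun card_prod cT card_bool mulnC [in leqRHS]mulnC.
  rewrite !expnMn mulnC mulnCA leq_mul2l cI leq_double_expn_pred ?orbT//.
  by rewrite expn_gt0.
move: low; rewrite sumr_const cardsCs finset.setCK -[leLHS]mulr_natl natrB ?max_card//.
move=> low.
have {}cbad2 : 2 * #|bad|%:R <= #|{ffun I -> T * bool}|%:R :> R.
  by rewrite -natrM ler_nat.
have : (#|{ffun I -> T * bool}|%:R - #|bad|%:R) * c <=
    ((4 ^ K) ^ #|I|)%:R * ((2 ^ #|I|)%:R * u).
  apply: le_trans low (le_trans le_T _).
  by apply: ler_wpM2l up; exact: ler0n.
have -> : ((4 ^ K) ^ #|I|)%:R * ((2 ^ #|I|)%:R * u) =
    #|{ffun I -> T * bool}|%:R * u.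
  by rewrite mulrA -natrM card_ffun card_prod cT card_bool expnMn.
have : 0 < #|{ffun I -> T * bool}|%:R :> R.
  by rewrite ltr0n card_ffun card_prod cT card_bool expn_gt0 muln_gt0 expn_gt0.
move: (#|{ffun I -> T * bool}|%:R) (#|bad|%:R) cbad2 => x y xy x_gt0 le_u.
have : 0 <= (x - 2 * y) * c by rewrite mulr_ge0 ?subr_ge0.
by move=> ?; rewrite -(ler_pM2l x_gt0); lra.
Qed.
End LazyIter.

(** * Distortion of maps from discrete tori *)

Lemma torus_distortion (R : realType) (B : metricType R) (p : R)
    (I : finType) (H : finZmodType) (g : {ffun I -> H} -> B) (t : H) K (U V : R) :
  0 < p -> roundness_exponent B p ->
  #|I| = (4 ^ K)%N -> t *+ 2 ^ K != 0 -> 0 <= V ->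
  (forall z v : {ffun I -> H}, (forall i, v i = t \/ v i = - t) ->
    mdist (g z) (g (z + v)) <= U) ->
  (forall z v : {ffun I -> H},
    (forall i, v i = 0 \/ v i = t *+ 2 ^ K \/ v i = - (t *+ 2 ^ K)) ->
    (exists i, v i <> 0) -> V <= mdist (g z) (g (z + v))) ->
  V <= 2 `^ p^-1 * U.
Proof.
move=> p0 hp cI t0 V0 gU gV.
pose Psi (v : {ffun I -> H}) := \sum_(z : {ffun I -> H}) mdist (g z) (g (z + v)) `^ p.
have U0 : 0 <= U.
  by apply: le_trans (mdist_ge0 _ _) (gU 0 [ffun=> t] _) => i; rewrite ffunE; left.
(* Moving the base point from [z] to [z + w] lets the double simplex inequality be applied for each
   [z] to the translated families [z + a s], [z + b s]. *)
have Psi_sub (v w : {ffun I -> H}) :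
    Psi (v - w) = \sum_(z : {ffun I -> H}) mdist (g (z + w)) (g (z + v)) `^ p.
  rewrite /Psi (reindex_inj (addIr w)) /=; apply: eq_bigr => z _.
  by rewrite -addrA (addrC w) subrK.
have cG : 0 < #|{ffun I -> H}|%:R :> R.
  by rewrite ltr0n; apply/card_gt0P; exists 0.
have sumc (x : R) : #|{ffun I -> H}|%:R * x = \sum_(z : {ffun I -> H}) x.
  by rewrite sumr_const mulr_natl.
have Vp : V `^ p <= 2 * U `^ p.
  rewrite -(ler_pM2l cG) mulrCA.
  apply: (@lazy_bound R I H Psi _ t K) => //.
  - move=> S a b S1.
    have exch (F : {ffun I -> H} -> S -> S -> R) :
        \sum_s \sum_s' \sum_(z : {ffun I -> H}) F z s s' =
        \sum_(z : {ffun I -> H}) \sum_s \sum_s' F z s s'.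
      by rewrite [RHS]exchange_big; apply: eq_bigr => s _; exact: exchange_big.
    under eq_bigr do under eq_bigr do rewrite !Psi_sub -big_split.
    under [in leRHS]eq_bigr do under eq_bigr do rewrite Psi_sub.
    rewrite !exch mulr_sumr; apply: ler_sum => z _.
    exact: (roundness_finType p0 hp (fun s => g (z + a s)) (fun s => g (z + b s)) S1).
  - by move=> v; apply: sumr_ge0 => z _; exact: powR_ge0.
  - by rewrite mulr_ge0 ?ler0n ?powR_ge0.
  - move=> v hv; rewrite /Psi sumc; apply: ler_sum => z _.
    by apply: (ge0_ler_powR (ltW p0)); rewrite ?nnegrE ?mdist_ge0 ?gU.
  - move=> v hv v0; rewrite /Psi sumc; apply: ler_sum => z _.
    by apply: (ge0_ler_powR (ltW p0)); rewrite ?nnegrE ?mdist_ge0 ?gV.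
rewrite leNgt; apply/negP => lt_V.
have := gt0_ltr_powR p0 (_ : 2 `^ p^-1 * U \in Num.nneg) (_ : V \in Num.nneg) lt_V.
rewrite !nnegrE mulr_ge0 ?powR_ge0// => /(_ isT V0).
by rewrite powRM ?powR_ge0// -powRrM mulVf ?gt_eqF// powRr1// ltNge Vp.
Qed.

(** * The distance to 0 on a cycle *)

Section Tent.
Variable q : nat.
Hypothesis q1 : (1 < q)%N.

(** The graph distance from [x] to 0 on the cycle of length [q]. *)
Definition tent (x : 'Z_q) : nat := minn x (q - x).

Lemma tent_add1 (x : 'Z_q) :
  ((tent (x + 1)%R <= (tent x).+1) && (tent x <= (tent (x + 1)%R).+1))%N.
Proof.
have xq : (x < q)%N by have := ltn_ord x; rewrite [X in (_ < X)%N]Zp_cast.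
have x1 : (x + 1)%R = (x.+1 %% q)%N :> nat by rewrite -val_Zp_nat // -natr1 natr_Zp.
rewrite /tent x1.
have [xq1|xq1] := ltnP x.+1 q; first by rewrite modn_small //; lia.
by have -> : x.+1 = q by [lia]; rewrite modnn; lia.
Qed.

Lemma tent_lip (R : realType) (x y : 'Z_q) : y = 1 \/ y = - 1 ->
  `|(tent x)%:R - (tent (x + y))%:R| <= 1 :> R.
Proof.
have nn (a b : nat) : ((a <= b.+1) && (b <= a.+1))%N -> `|a%:R - b%:R| <= 1 :> R.
  by rewrite -!(ler_nat R) -!natr1 ler_norml => /andP[ab ba]; apply/andP; split; lra.
(* The step [- 1] from [x] is the step [1] from [x - 1], reversed. *)
by move=> [] ->; apply: nn;
  [have := tent_add1 x|have := tent_add1 (x - 1)]; rewrite ?subrK; lia.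
Qed.
End Tent.

(** * Discrete tori in [c0] and their locally finite union *)

Section C0.
Context {R : realType}.

Lemma c0_distE (u v : c0 R) : mdist u v = supnorm (u - v).
Proof. by []. Qed.

Lemma c0_coord_le_dist (u v : c0 R) n : `|u n - v n| <= mdist u v.
Proof.
rewrite c0_distE; apply: ub_le_sup; last by exists n.
have /set_mem/= u0 := c0_seqP (u - v).
have /cvg_seq_bounded [M [_ Mu]] : cvgn (u - v : c0 R) by apply/cvg_ex; exists 0.
by exists (M + 1) => _ [k _ <-]; apply: Mu => //; rewrite ltrDl.
Qed.

Lemma c0_dist_le (u v : c0 R) c : (forall n, `|u n - v n| <= c) -> mdist u v <= c.
Proof.
move=> h; rewrite c0_distE; apply: ge_sup; last by move=> _ [n _ <-]; exact: h.
by exists `|(u - v) 0%N|; exists 0%N.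
Qed.

Section Piece.
Variables (K : nat) (s : R).
Notation H := 'Z_(2 ^ K.+1).
Notation J := ('I_(4 ^ K) * H)%type.

(* Coordinate [0] labels the torus; the others record the distance of each
   coordinate of [z] to each point [x] of the cycle. *)
Definition torus_seq (z : {ffun 'I_(4 ^ K) -> H}) (n : nat) : R :=
  if n is k.+1 then
    if (insub k : option 'I_#|{: J}|) is Some j then
      s * (tent (z (enum_val j).1 - (enum_val j).2))%:R else 0
  else K%:R.

Lemma torus_seqP z : torus_seq z \in cvg_to0 R.
Proof.
rewrite inE /=; apply: cvg_near_cst; exists #|{: J}|.+1 => // -[|n] //=.
by rewrite ltnS => h; rewrite insubF // ltnNge h.
Qed.

Definition torus_c0 z : c0 R := C0 (torus_seqP z).

Lemma torus_seqE z i x : torus_seq z (enum_rank (i, x)).+1 = s * (tent (z i - x))%:R.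
Proof. by rewrite /torus_seq valK enum_rankK. Qed.

Hypothesis s0 : 0 <= s.

Lemma torus_dist_le (z v : {ffun 'I_(4 ^ K) -> H}) :
  (forall i, v i = 1 \/ v i = - 1) ->
  mdist (torus_c0 z) (torus_c0 (z + v)) <= s.
Proof.
move=> hv; apply: c0_dist_le => -[|n] /=; first by rewrite subrr normr0.
case: insubP => [j _ _|_]; last by rewrite subrr normr0.
rewrite -mulrBr normrM (ger0_norm s0) ler_piMr// ffunE addrAC; apply: tent_lip => //.
by rewrite (ltn_exp2l 0).
Qed.

(** The coordinate labelled [(i, z i)] separates the points: it is 0 at [z] and [s * 2 ^ K] at
    [z + v], whose [i]-th entry is antipodal to [z i]. *)
Lemma torus_dist_ge (z v : {ffun 'I_(4 ^ K) -> H}) i : v i = 1 *+ 2 ^ K ->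
  s * (2 ^ K)%:R <= mdist (torus_c0 z) (torus_c0 (z + v)).
Proof.
move=> vi; have := c0_coord_le_dist (torus_c0 z) (torus_c0 (z + v))
  (enum_rank (i, z i)).+1.
rewrite [c0_seq (torus_c0 z) _]torus_seqE [c0_seq (torus_c0 _) _]torus_seqE.
rewrite ffunE addrAC subrr add0r vi {1}/tent min0n mulr0 sub0r normrN.
rewrite normrM !ger0_norm //; apply: le_trans; rewrite ler_wpM2l // ler_nat.
have K1 : (1 < 2 ^ K.+1)%N by rewrite (ltn_exp2l 0).
rewrite /tent val_Zp_nat // modn_small ?ltn_exp2l //.
by rewrite expnS mul2n -addnn addnK minnn.
Qed.
End Piece.

Variable s : nat -> R.
Definition tori : set (c0 R) := [set u | exists K z, u = @torus_c0 K (s K) z].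

Definition tori_pt K z : tori :=
  SigSub (mem_set (ex_intro _ K (ex_intro _ z erefl)) : @torus_c0 K (s K) z \in tori).

(** Coordinate 0 equals [K] on the [K]-th torus, so a ball of radius [r] about a point of the
    [K0]-th torus only meets tori with [K < K0 + r], each of them finite. *)
Lemma tori_locally_finite : locally_finite (tori : metricType R).
Proof.
move=> x r.
have /set_mem [K0 [z0 x0]] := valP x.
have [M hM] : exists M : nat, K0%:R + r <= M%:R.
  exists (Num.bound `|K0%:R + r|).
  exact/ltW/(le_lt_trans (ler_norm _))/archi_boundP/normr_ge0.
apply: (@sub_finite_set _ _ (\bigcup_(K in `I_M) range (@tori_pt K))).
  move=> y; rewrite ballEmdist /= => xy.
  have /set_mem [K [z yK]] := valP y.
  exists K; last by exists z => //; apply: val_inj.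
  rewrite /= -(ltr_nat R); apply: lt_le_trans hM.
  have : `|set_val x 0%N - set_val y 0%N| < r := le_lt_trans (c0_coord_le_dist _ _ _) xy.
  rewrite (x0 : set_val x = _) (yK : set_val y = _) /= ltr_norml => /andP[? ?]; lra.
apply: bigcup_finite => // K _; exact: finite_image.
Qed.
End C0.

(** * Excluding uniform and coarse embeddings *)

Section Embeddings.
Context {R : realType}.
Implicit Types X Y B : metricType R.

(** All powers equal 1, even at distance 0, so the inequality reads [n(n - 1) <= n ^ 2]. *)
Lemma roundness_exponent0 B : roundness_exponent B 0.
Proof.
split => // n x y _.
rewrite (eq_bigr (fun i : 'I_n => \sum_(j < n | (i < j)%N) (1 + 1 : R))); last first.
  by move=> i _; apply: eq_bigr => j _; rewrite !powRr0.
rewrite [leRHS](eq_bigr (fun i : 'I_n => \sum_(j < n) (1 : R))); last first.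
  by move=> i _; apply: eq_bigr => j _; rewrite !powRr0.
under eq_bigr do rewrite big_split; rewrite big_split /=.
rewrite [X in _ + X](exchange_big_dep xpredT) //= -big_split /=.
apply: ler_sum => i _; rewrite [leRHS](bigID (fun j : 'I_n => (i < j)%N)) lerD2l.
rewrite [leRHS](bigID (fun j : 'I_n => (j < i)%N)) /=.
rewrite [X in _ <= X + _](eq_bigl (fun j : 'I_n => (j < i)%N)); last first.
  by move=> j; case: ltngtP.
by rewrite lerDl sumr_ge0.
Qed.

Lemma roundness_exponent_gt0 B : generalized_roundness B <> 0%E ->
  exists2 p : R, 0 < p & roundness_exponent B p.
Proof.
move=> B0; apply: contrapT => noexp; apply: B0; apply/eqP.
rewrite eq_le; apply/andP; split.
  apply: ge_ereal_sup => _ [p /= hp <-]; rewrite lee_fin leNgt.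
  by apply/negP => p0; apply: noexp; exists p.
by apply: ereal_sup_ubound; exists 0 => //; exact: roundness_exponent0.
Qed.

Lemma range_invK X Y (f : X -> Y) (y : range f) : f (range_inv y) = set_val y.
Proof. by rewrite /range_inv; case: cid2. Qed.

Lemma lipschitz_embedding_bilip X Y (f : X -> Y) : lipschitz_embedding f ->
  exists2 k : R, 0 < k & forall x y,
    mdist (f x) (f y) <= k * mdist x y /\ mdist x y <= k * mdist (f x) (f y).
Proof.
move=> [f_inj [k1 f1] [k2 f2]].
(* The 1 makes the common constant positive. *)
exists (Num.max 1 (Num.max k1 k2)); first by rewrite lt_max ltr01.
move=> x y; split.
  by apply: le_trans (f1 x y) _; rewrite ler_wpM2r ?mdist_ge0// !le_max lexx orbT.
have fr z : f z \in range f by apply/mem_set; exists z.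
have fK z : range_inv (SigSub (fr z)) = z by apply: f_inj; rewrite range_invK.
have := f2 (SigSub (fr x)) (SigSub (fr y)); rewrite !fK => /le_trans; apply.
by rewrite ler_wpM2r ?mdist_ge0// !le_max lexx !orbT.
Qed.

Lemma set_val_lipschitz_embedding X (A : set X) :
  lipschitz_embedding (set_val : A -> X).
Proof.
split; first exact: val_inj.
  by exists 1 => x y; rewrite mul1r.
exists 1 => x y; rewrite mul1r.
by rewrite -[leLHS]/(mdist (set_val (range_inv x)) (set_val (range_inv y))) !range_invK.
Qed.

Lemma unif_continuous_mdist X Y (f : X -> Y) : unif_continuous f ->
  forall e, 0 < e -> exists2 d, 0 < d &
    forall x y, mdist x y < d -> mdist (f x) (f y) < e.
Proof.
move=> /unif_continuousP fc e /fc[d d0 fd]; exists d => // x y xy.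
by have := fd (x, y); rewrite !ballEmdist; apply.
Qed.

(** Contrapositive of the uniform continuity of the inverse. *)
Lemma uniform_embedding_expand X Y (f : X -> Y) : uniform_embedding f ->
  forall e, 0 < e -> exists2 d, 0 < d &
    forall x y, e <= mdist x y -> d <= mdist (f x) (f y).
Proof.
move=> [f_inj _ /unif_continuous_mdist fc] e /fc[d d0 fd]; exists d => // x y.
apply: contraLR; rewrite -!ltNge => xy.
have fr z : f z \in range f by apply/mem_set; exists z.
have fK z : range_inv (SigSub (fr z)) = z by apply: f_inj; rewrite range_invK.
by have := fd (SigSub (fr x)) (SigSub (fr y)); rewrite !fK; apply.
Qed.

Lemma tori_distortion B (p : R) (s : nat -> R) (g : tori s -> B) K (U V : R) :
  0 < p -> roundness_exponent B p -> 0 <= s K -> 0 <= V ->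
  (forall x y : tori s, mdist x y <= s K -> mdist (g x) (g y) <= U) ->
  (forall x y : tori s, s K * (2 ^ K)%:R <= mdist x y -> V <= mdist (g x) (g y)) ->
  V <= 2 `^ p^-1 * U.
Proof.
move=> p0 hp s0 V0 gU gV.
have K1 : (1 < 2 ^ K.+1)%N by rewrite (ltn_exp2l 0).
(* The antipode of 0 is its own opposite, so every nonzero [v i] falls under [torus_dist_ge]. *)
have opp2 : - (1 *+ 2 ^ K) = 1 *+ 2 ^ K :> 'Z_(2 ^ K.+1).
  apply/eqP; rewrite -subr_eq0 -opprD oppr_eq0 -mulrnDr addnn -mul2n -expnS.
  by rewrite pchar_Zp.
apply: (@torus_distortion R B p 'I_(4 ^ K) 'Z_(2 ^ K.+1)
  (fun z => g (@tori_pt R s K z)) 1 K U V) => //.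
- by rewrite card_ord.
- rewrite -val_eqE /= val_Zp_nat// modn_small ?ltn_exp2l//.
  by rewrite -lt0n expn_gt0.
- by move=> z v hv; apply: gU; exact: torus_dist_le.
- move=> z v hv [i vi]; apply: gV; apply: (@torus_dist_ge R K (s K) s0 z v i).
  by have [//|[->|->]] := hv i; rewrite ?opp2.
Qed.

(** At scale [2 ^ -K] antipodes stay at distance at least 1, so [V] is independent of [K], while
    unit steps shrink to 0. *)
Lemma no_uniform_embedding Y B (p : R) (f : Y -> B)
    (h : tori (fun K => (2 ^ K)%:R^-1 : R) -> Y) :
  0 < p -> roundness_exponent B p -> lipschitz_embedding h ->
  ~ uniform_embedding f.
Proof.
move=> p0 hp /lipschitz_embedding_bilip[k k0 hk] fU.
have kV0 : 0 < k^-1 by rewrite invr_gt0.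
have [V V0 fV] := uniform_embedding_expand fU kV0.
have [_ /unif_continuous_mdist fc _] := fU.
pose c : R := 2 `^ p^-1.
have c0 : 0 < c by rewrite powR_gt0.
(* This choice of [U] turns the distortion bound into [V <= V / 2]. *)
have [d d0 fd] := fc _ (divr_gt0 V0 (mulr_gt0 (ltr0n _ 2) c0) : 0 < V / (2 * c)).
have [K hK] : exists K, k * (2 ^ K)%:R^-1 < d.
  exists (Num.bound (k / d)); rewrite ltr_pdivrMr ?ltr0n ?expn_gt0//.
  rewrite mulrC -ltr_pdivrMr//.
  apply: lt_trans (archi_boundP (ltW (divr_gt0 k0 d0))) _.
  by rewrite ltr_nat ltn_expl.
have := @tori_distortion B p _ (f \o h) K (V / (2 * c)) V p0 hp _ (ltW V0).
rewrite invr_ge0 ler0n => /(_ isT).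
have -> : 2 `^ p^-1 * (V / (2 * c)) = V / 2.
  by rewrite -/c; field; rewrite gt_eqF.
move=> H; have : V <= V / 2; last by lra.
apply: H => x y xy.
  apply/ltW/fd; apply: le_lt_trans hK; apply: le_trans (hk x y).1 _.
  by rewrite ler_pM2l.
apply: fV; rewrite -(ler_pM2l k0) divff ?gt_eqF//.
apply: le_trans (hk x y).2; apply: le_trans xy.
by rewrite mulVf// pnatr_eq0 -lt0n expn_gt0.
Qed.

(** At scale 1 unit steps have images within [rho2 k] for every [K], while antipodes are at least
    [2 ^ K / k] apart in [Y], which forces [rho1] to stay bounded. *)
Lemma no_coarse_embedding Y B (p : R) (f : Y -> B)
    (h : tori (fun=> 1 : R) -> Y) :
  0 < p -> roundness_exponent B p -> lipschitz_embedding h ->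
  ~ coarse_embedding f.
Proof.
move=> p0 hp /lipschitz_embedding_bilip[k k0 hk].
move=> [rho1 [rho2 [[rho10 rho1m] [rho20 rho2m] hrho rho1oo]]].
pose C : R := 2 `^ p^-1 * rho2 k.
have /cvgryPgt/(_ C)[A [_ hA]] := rho1oo.
(* [rho1] is monotone only on nonnegative reals, and [hA] holds strictly above [A]. *)
pose t0 := Num.max 0 (A + 1).
have t00 : 0 <= t0 by rewrite le_max lexx.
have ht0 : C < rho1 t0 by apply: hA; rewrite lt_max ltrDl ltr01 orbT.
have [K hK] : exists K, k * t0 <= (2 ^ K)%:R.
  exists (Num.bound (k * t0)); apply/ltW.
  apply: lt_trans (archi_boundP (mulr_ge0 (ltW k0) t00)) _.
  by rewrite ltr_nat ltn_expl.
suff : rho1 t0 <= C by rewrite leNgt ht0.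
apply: (@tori_distortion B p _ (f \o h) K _ _ p0 hp) => // [|x y xy|x y xy].
- exact: rho10.
- apply: le_trans (hrho _ _).2 _; apply: rho2m; first exact: mdist_ge0.
  by apply: le_trans (hk x y).1 _; rewrite ler_piMr// ltW.
- apply: le_trans (hrho _ _).1; apply: rho1m => //=.
  rewrite -(ler_pM2l k0); apply: le_trans (hk x y).2.
  by apply: le_trans xy; rewrite mul1r.
Qed.

(** Common form of both claims: [c0 R] contains every [tori s], and a universal space receives it by
    local finiteness. *)
Lemma no_embedding Y B :
  (forall s : nat -> R, exists h : tori s -> Y, lipschitz_embedding h) ->
  generalized_roundness B <> 0%E ->
  ~ (exists f : Y -> B, uniform_embedding f) /\
  ~ (exists f : Y -> B, coarse_embedding f).
Proof.
move=> Yh /roundness_exponent_gt0[p p0 hp]; split=> -[f].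
  have [h hh] := Yh (fun K => (2 ^ K)%:R^-1); exact: (no_uniform_embedding p0 hp hh).
have [h hh] := Yh (fun=> 1); exact: (no_coarse_embedding p0 hp hh).
Qed.
End Embeddings.

Theorem corollary4p7 (R : realType) :
  (forall B : metricType R, generalized_roundness B <> 0%E ->
    ~ (exists f : c0 R -> B, uniform_embedding f) /\
    ~ (exists f : c0 R -> B, coarse_embedding f)) /\
  (forall Y B : metricType R,
    lipschitz_universal (@locally_finite R) Y ->
    generalized_roundness B <> 0%E ->
    ~ (exists f : Y -> B, uniform_embedding f) /\
    ~ (exists f : Y -> B, coarse_embedding f)).
Proof.
split=> [B|Y B Yuniv]; apply: no_embedding => s.
  by exists set_val; exact: set_val_lipschitz_embedding.
by apply: Yuniv; exact: tori_locally_finite.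
Qed.
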